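(* Let $\{A_0=I_{n-1}, A_1, A_2={}^tA_1\}$ be a non-symmetric association scheme of rank $3$ and order $n-1$, and let $\sigma_h$ ($h\in H$) and $\mu_g$ ($g\in G\setminus H$) be the $4n\times 4n$ matrices constructed from it in the context. Then the set $\mathcal{D}=\{\sigma_h\mid h\in H\}\cup\{\mu_g\mid g\in G\setminus H\}$ forms an association scheme.
   Context: ${}^tM$ is the transpose of $M$, $I_N$ the $N\times N$ identity matrix, $J_N$ the $N\times N$ all-ones matrix, $\otimes$ the Kronecker product. Association scheme: a set $\mathcal{S}=\{S_0,\dots,S_d\}$ of $d+1$ non-zero $N\times N$ matrices with entries in $\{0,1\}$ is an association scheme of order $N$ and rank $d+1$ if (1) $S_0=I_N$; (2) $\sum_{i=0}^d S_i=J_N$; (3) for all $0\le i,j\le d$, ${}^tS_i$ and $S_iS_j$ are linear combinations of $S_0,\dots,S_d$. It is symmetric if ${}^tS_i=S_i$ for all $i$, and non-symmetric otherwise. Group: let $x,y$ be the permutation matrices $$x=\begin{pmatrix}0&1&0&0\\0&0&1&0\\0&0&0&1\\1&0&0&0\end{pmatrix},\quad y=\begin{pmatrix}0&1&0&0\\1&0&0&0\\0&0&0&1\\0&0&1&0\end{pmatrix}$$ and $G=\langle x,y\rangle\cong D_8$ the group of order $8$ generated by them under matrix multiplication; its identity is $1=I_4$. Let $H=C_G(y)=\{1,x^2,y,x^2y\}$, so $G\setminus H=\{x,x^3,xy,x^3y\}$. Construction of $\mathcal{D}$: given the scheme $\{A_0,A_1,A_2\}$ of order $n-1$ (it is known that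 then $n\equiv 0\pmod 4$), define $n\times n$ block matrices (blocks of sizes $1$ and $n-1$; $\mathbf{1}$ is the all-ones row vector of length $n-1$) $$E=\begin{pmatrix}0&\mathbf{1}\\ {}^t\mathbf{1}&O\end{pmatrix},\qquad \tilde{A}_i=\begin{pmatrix}0&0\\0&A_i\end{pmatrix}\ (i=1,2).$$ Define $4n\times 4n$ matrices $\sigma_h=I_n\otimes h$ for $h\in H$ and $\mu_g=E\otimes g+\tilde{A}_1\otimes gy+\tilde{A}_2\otimes gx^2y$ for $g\in G\setminus H$. *)

(* Defs.v *)
From HB Require Import structures.
From mathcomp Require Import all_boot all_order all_fingroup all_algebra.
From mathcomp Require Import finmap.
From mathcomp Require Export mxtens.

Set Implicit Arguments.
Unset Strict Implicit.
Unset Printing Implicit Defensive.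

Import Order.TTheory GRing.Theory Num.Theory.
Local Open Scope fset_scope.
Local Open Scope ring_scope.

Section AssociationScheme.

Variables (R : numFieldType) (N : nat).
Implicit Types (M : 'M[R]_N) (S : {fset 'M[R]_N}).

Definition is01mx M := [forall i, forall j, (M i j == 0) || (M i j == 1)].

(* The scheme is the unindexed set {S_0, ..., S_d}, so S_0 = I_N becomes
   membership of 1%:M, and linear combinations are the span of the set. *)
Record assoc_scheme S : Prop := AssocScheme {
  assoc_scheme_neq0 : forall M, M \in S -> M != 0;
  assoc_scheme_01 : forall M, M \in S -> is01mx M;
  assoc_scheme_one : 1%:M \in S;
  assoc_scheme_sum : \sum_(M <- S) M = const_mx 1;
  assoc_scheme_tr : forall M, M \in S -> M^T \in <<S>>%VS;
  assoc_scheme_mul :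
    forall M1 M2, M1 \in S -> M2 \in S -> M1 *m M2 \in <<S>>%VS
}.

Definition scheme_rank S : nat := #|` S|.

Definition symmetric_scheme S := forall M, M \in S -> M^T = M.

Definition nonsymmetric_scheme S := ~ symmetric_scheme S.

End AssociationScheme.

(* Permutation matrices are represented by the permutations s : 'S_4, through
   perm_mx s i j = (s i == j); since perm_mx (s * t) = perm_mx s *m perm_mx t,
   products of permutations are products of matrices in the same order.
   See perm_mx_gx, perm_mx_gy, groupHE and groupGDHE below. *)
Definition gx : 'S_4 := perm (addrI (1 : 'I_4)).

Definition gy : 'S_4 :=
  (tperm (inord 0) (inord 1) * tperm (inord 2) (inord 3))%g.

Definition groupG : {group 'S_4} := <<[set gx; gy]>>%G.

Definition groupH : {group 'S_4} := 'C_groupG[gy]%G.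

Section Construction.

Variables (R : numFieldType) (m : nat).

Definition Emx : 'M[R]_(1 + m) := block_mx 0 (const_mx 1) (const_mx 1) 0.

Definition tildemx (A : 'M[R]_m) : 'M[R]_(1 + m) := block_mx 0 0 0 A.

Definition sigma (h : 'S_4) : 'M[R]_((1 + m) * 4) :=
  tensmx (1%:M : 'M[R]_(1 + m)) (perm_mx h).

Definition mu (A1 A2 : 'M[R]_m) (g : 'S_4) : 'M[R]_((1 + m) * 4) :=
  tensmx Emx (perm_mx g)
  + tensmx (tildemx A1) (perm_mx (g * gy)%g)
  + tensmx (tildemx A2) (perm_mx (g * gx ^+ 2 * gy)%g).

Definition schemeD (A1 A2 : 'M[R]_m) : {fset 'M[R]_((1 + m) * 4)} :=
  [fset sigma h | h in groupH]
  `|` [fset mu A1 A2 g | g in (groupG :\: groupH)%SET].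

End Construction.

Definition mx_of_rows (R : pzSemiRingType) (rows : seq (seq nat)) : 'M[R]_4 :=
  \matrix_(i, j) (nth 0%N (nth [::] rows i) j)%:R.

Lemma ord4P (P : 'I_4 -> Prop) :
  P (inord 0) -> P (inord 1) -> P (inord 2) -> P (inord 3) -> forall i, P i.
Proof.
move=> P0 P1 P2 P3 i; rewrite -(inord_val i).
by case: i => [[|[|[|[|//]]]] ?].
Qed.

Lemma gxE (i : 'I_4) : val (gx i) = ((1 + i) %% 4)%N.
Proof. by rewrite permE. Qed.

Lemma gyE (i : 'I_4) : val (gy i) = nth 0%N [:: 1; 0; 3; 2]%N i.
Proof.
move: i; apply: ord4P; rewrite permM /tperm; do 2 rewrite permE /=;
by rewrite -!val_eqE /= ?(inordK, permE) //= -?val_eqE ?(inordK, permE) //=.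
Qed.

Lemma perm_mx_gx (R : pzSemiRingType) : perm_mx gx =
  mx_of_rows R [:: [:: 0; 1; 0; 0]; [:: 0; 0; 1; 0];
                   [:: 0; 0; 0; 1]; [:: 1; 0; 0; 0]]%N.
Proof.
apply/matrixP => i j; rewrite !mxE -val_eqE gxE.
by case: i => [[|[|[|[|//]]]] ?]; case: j => [[|[|[|[|//]]]] ?].
Qed.

Lemma perm_mx_gy (R : pzSemiRingType) : perm_mx gy =
  mx_of_rows R [:: [:: 0; 1; 0; 0]; [:: 1; 0; 0; 0];
                   [:: 0; 0; 0; 1]; [:: 0; 0; 1; 0]]%N.
Proof.
apply/matrixP => i j; rewrite !mxE -val_eqE gyE.
by case: i => [[|[|[|[|//]]]] ?]; case: j => [[|[|[|[|//]]]] ?].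
Qed.

Lemma perm4P (s t : 'S_4) :
  (forall i : 'I_4, val (s i) = val (t i)) -> s = t.
Proof. by move=> st; apply/permP => i; apply: val_inj; apply: st. Qed.

Lemma gx4 : (gx ^+ 4 = 1)%g.
Proof.
apply: perm4P => i; rewrite (permX gx i 4) perm1 /= !gxE.
by case: i => [[|[|[|[|//]]]] ?].
Qed.

Lemma gy2 : (gy ^+ 2 = 1)%g.
Proof.
apply: perm4P => i; rewrite (permX gy i 2) perm1 /= !gyE.
by case: i => [[|[|[|[|//]]]] ?].
Qed.

Lemma gyx : (gy * gx = gx ^+ 3 * gy)%g.
Proof.
apply: perm4P => i; rewrite (permM gy gx) (permM (gx ^+ 3)%g gy) (permX gx i 3) /=.
rewrite gxE !gyE !gxE.
by case: i => [[|[|[|[|//]]]] ?].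
Qed.

Definition dihedral_elts (gT : finGroupType) (a b : gT) : seq gT :=
  [:: 1; a; a ^+ 2; a ^+ 3; b; a * b; a ^+ 2 * b; a ^+ 3 * b]%g.

Lemma mem_gen_dihedral (gT : finGroupType) (a b : gT) :
  (a ^+ 4 = 1 -> b ^+ 2 = 1 -> b * a = a ^+ 3 * b ->
  forall g, (g \in <<[set a; b]>>) = (g \in dihedral_elts a b))%g.
Proof.
move=> a4 b2 ba g.
have xG : a \in <<[set a; b]>>%g by rewrite mem_gen // !inE eqxx.
have yG : b \in <<[set a; b]>>%g by rewrite mem_gen // !inE eqxx orbT.
apply/idP/idP; last first.
  by rewrite !inE; do 7!(case/orP; first by move/eqP->; rewrite ?groupM ?groupX ?group1);
    move/eqP->; rewrite ?groupM ?groupX.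
case/gen_prodgP => n [c cP ->]; elim: n c cP => [|n IHn] c cP.
  by rewrite big_ord0 !inE eqxx.
rewrite big_ord_recr /= /dihedral_elts.
have {IHn} := IHn (fun i => c (widen_ord (leqnSn n) i)) (fun i => cP _).
move: (\prod_(i < n) _)%g => p.
have xx : (a * a = a ^+ 2)%g by rewrite expgS expg1.
have x2x : (a ^+ 2 * a = a ^+ 3)%g by rewrite -expgSr.
have x3x : (a ^+ 3 * a = 1)%g by rewrite -expgSr a4.
have yy : (b * b = 1)%g by rewrite -b2 expgS expg1.
have yx : (a * b * a = b)%g by rewrite -mulgA ba mulgA -expgS a4 mul1g.
have x2yx : (a ^+ 2 * b * a = a * b)%g.
  by rewrite -mulgA ba mulgA -expgD (expgD _ 4 1) a4 mul1g expg1.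
have x3yx : (a ^+ 3 * b * a = a ^+ 2 * b)%g.
  by rewrite -mulgA ba mulgA -expgD (expgD _ 4 2) a4 mul1g.
have := cP ord_max; rewrite !inE => /orP[] /eqP -> pP.
  by move: pP; do 7!(case/orP; first by move/eqP->;
      rewrite ?mul1g ?ba ?xx ?x2x ?x3x ?yx ?x2yx ?x3yx ?eqxx ?orbT);
    move/eqP->; rewrite ?x3yx ?eqxx ?orbT.
by move: pP; do 7!(case/orP; first by move/eqP->;
      rewrite -?mulgA ?yy ?mulg1 ?mul1g ?eqxx ?orbT);
    move/eqP->; rewrite -?mulgA ?yy ?mulg1 ?eqxx ?orbT.
Qed.


Lemma dihedral_cent1 (gT : finGroupType) (a b : gT) :
  (a ^+ 4 = 1 -> b ^+ 2 = 1 -> b * a = a ^+ 3 * b -> a ^+ 2 != 1 ->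
  forall g, (g \in 'C_<<[set a; b]>>[b]) = (g \in [:: 1; a ^+ 2; b; a ^+ 2 * b])
  /\ (g \in <<[set a; b]>> :\: 'C_<<[set a; b]>>[b]) =
     (g \in [:: a; a ^+ 3; a * b; a ^+ 3 * b]))%g.
Proof.
move=> a4 b2 ba a2 g.
have Zb : (b \in 'C[b])%g by apply: cent1id.
have Za2 : (a ^+ 2 \in 'C[b])%g.
  apply/cent1P; rewrite /commute expgS expg1 [RHS]mulgA ba -[RHS]mulgA ba.
  by rewrite mulgA -expgD (expgD _ 4 2) a4 mul1g expgS expg1.
have Za : (a \in 'C[b])%g = false.
  apply/negP => /cent1P; rewrite /commute ba expgSr -mulgA.
  move/(congr1 (fun z => z * (a * b)^-1))%g; rewrite mulgV mulgK => a21.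
  by rewrite -a21 eqxx in a2.
have Za3 : (a ^+ 3 \in 'C[b])%g = false by rewrite expgS groupMr ?Za.
have Zab : (a * b \in 'C[b])%g = false by rewrite groupMr ?Za.
have Za3b : (a ^+ 3 * b \in 'C[b])%g = false by rewrite groupMr ?Za3.
have Za2b : (a ^+ 2 * b \in 'C[b])%g by rewrite groupM.
have sub (s t : seq gT) : (forall x, x \in s -> x \in 'C[b]%g) ->
    (forall x, x \in t -> x \in 'C[b]%g = false) ->
    (g \in dihedral_elts a b) = (g \in s) || (g \in t) ->
    (g \in 'C_<<[set a; b]>>[b])%g = (g \in s) /\
    (g \in <<[set a; b]>> :\: 'C_<<[set a; b]>>[b])%g = (g \in t).
  move=> sZ tZ st.
  rewrite in_setD in_setI mem_gen_dihedral // st.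
  have [gs|ngs] := boolP (g \in s).
    rewrite (sZ _ gs) /=; split=> //; apply/esym/negP => /tZ.
    by rewrite (sZ _ gs).
  by have [/tZ ->|] := boolP (g \in t).
apply: sub.
- by move=> x; rewrite mem_seq4 => /or4P[] /eqP->; rewrite ?group1.
- by move=> x; rewrite mem_seq4 => /or4P[] /eqP->.
rewrite !inE; move: (g == 1)%g (g == a)%g (g == a ^+ 2)%g (g == a ^+ 3)%g.
move: (g == b)%g (g == a * b)%g (g == a ^+ 2 * b)%g (g == a ^+ 3 * b)%g.
by do 8!case.
Qed.

Lemma gx2_neq1 : (gx ^+ 2 != 1)%g.
Proof.
apply/eqP => /permP/(_ (inord 0))/(congr1 val).
by rewrite (permX gx _ 2) perm1 /= !gxE inordK.
Qed.

Lemma groupHE (h : 'S_4) :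
  (h \in groupH) = (h \in [:: 1; gx ^+ 2; gy; gx ^+ 2 * gy]%g).
Proof. by have [] := dihedral_cent1 gx4 gy2 gyx gx2_neq1 h. Qed.

Lemma groupGDHE (g : 'S_4) :
  (g \in groupG :\: groupH) = (g \in [:: gx; gx ^+ 3; gx * gy; gx ^+ 3 * gy]%g).
Proof. by have [] := dihedral_cent1 gx4 gy2 gyx gx2_neq1 g. Qed.

(* Main.v *)
Require Import Defs.
From mathcomp Require Import all_boot all_order all_fingroup all_algebra.
From mathcomp Require Import finmap ring.

(* Write z = x^2 and M = E (x) 1 + A~_1 (x) y + A~_2 (x) zy, so that
   mu_g = (I (x) g) M.  The elements g of G \ H satisfy y g = g z y, so moving
   g across M exchanges y and zy.  The rank 3 scheme satisfies
   A_1 A_2 = A_2 A_1 = k I + b (A_1 + A_2) and A_1^2 + A_2^2 = k (A_1 + A_2) with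
   n - 1 = 2 k + 1 and k = 2 b + 1; hence mu_g mu_g' equals
   (n - 1) sigma_h + k (F (x) h (1 + z) + E (x) h (y + zy)) with h = g g' and
   F = A~_1 + A~_2.  As 4 x 4 matrices (not in the group algebra)
   y + zy = x + x^3, which turns the bracket into mu_{hx} + mu_{hx^3}. *)

Set Implicit Arguments.
Unset Strict Implicit.
Unset Printing Implicit Defensive.
Import Order.TTheory GRing.Theory Num.Theory.

Local Open Scope fset_scope.
Local Open Scope ring_scope.

(** * Three-element sets and products of all-ones matrices *)

Lemma span_fset3P (K : fieldType) (vT : vectType K) (u v w t : vT) :
  t \in <<[fset u; v; w]>>%VS ->
  exists a b c, t = a *: u + b *: v + c *: w.
Proof.
have sub : (<<[fset u; v; w]>> <= <<[:: u; v; w]>>)%VS.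
  by apply: sub_span => s; rewrite !inE orbA.
move=> /(subvP sub); rewrite !span_cons span_nil addv0.
case/memv_addP => _ /vlineP[a ->] [_ /memv_addP[_ /vlineP[b ->] [_ /vlineP[c ->] ->]] ->].
by exists a, b, c; rewrite addrA.
Qed.

Lemma cardfs3_uniq (T : choiceType) (u v w : T) :
  #|` [fset u; v; w]| = 3%N -> uniq [:: u; v; w].
Proof.
rewrite /= !inE.
have [->|uv] := eqVneq u v; first by rewrite fsetUid cardfs2; case: eqP.
have [->|uw] := eqVneq u w.
  by rewrite fsetUC fsetUA fsetUid cardfs2; case: eqP.
by have [->|vw] := eqVneq v w; first by rewrite -fsetUA fsetUid cardfs2; case: eqP.
Qed.

Lemma mulmx_ones (R : pzSemiRingType) m p q :
  (const_mx 1 : 'M[R]_(p, m)) *m (const_mx 1 : 'M_(m, q)) = const_mx m%:R.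
Proof.
apply/matrixP => i j; rewrite !mxE (eq_bigr (fun=> 1)) => [|l _].
  by rewrite sumr_const card_ord.
by rewrite !mxE mulr1.
Qed.

(** * Tournament matrices *)

Section Tournament.

Variables (R : numFieldType) (m : nat) (A : 'M[R]_m).
Hypothesis A01 : is01mx A.
Hypothesis A_tournament : 1%:M + A + A^T = const_mx 1.

Lemma tournament_entry i j :
  (i == j, A i j, A j i) \in [:: (true, 0, 0); (false, 1, 0); (false, 0, 1)].
Proof.
have bool01 k l : exists b : bool, A k l = b%:R.
  by have /orP[/eqP->|/eqP->] := forallP (forallP A01 k) l; [exists false | exists true].
have := congr1 (fun M : 'M_m => M i j) A_tournament; rewrite !mxE.
have [[a ->] [b ->]] := (bool01 i j, bool01 j i).
(* Characteristic 0 turns this into an equation between naturals, so exactly one of the three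
   booleans is true. *)
move/eqP; rewrite -!natrD -[1]/(1%:R) eqr_nat.
by case: (i == j); case: a; case: b => h; by [case: h | rewrite !inE eqxx ?orbT].
Qed.

Lemma tournament_diag i : A i i = 0.
Proof.
by have := tournament_entry i i; rewrite eqxx !inE !xpair_eqE /= !orbF => /andP[/eqP].
Qed.

End Tournament.

(** * Intersection numbers of the rank 3 scheme *)

Section IntersectionNumbers.

Variables (R : numFieldType) (m : nat) (A : 'M[R]_m).
Hypothesis schA : assoc_scheme [fset 1%:M; A; A^T].
Hypothesis rankA : scheme_rank [fset 1%:M; A; A^T] = 3%N.

Lemma scheme3_01 : is01mx A.
Proof. by apply: (assoc_scheme_01 schA); rewrite !inE eqxx orbT. Qed.

Lemma scheme3_tournament : 1%:M + A + A^T = const_mx 1.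
Proof.
rewrite -(assoc_scheme_sum schA).
rewrite (perm_big [:: 1%:M; A; A^T]) /=; first by rewrite !big_cons big_nil addr0 addrA.
apply: uniq_perm; rewrite ?fset_uniq //; first exact: cardfs3_uniq.
by move=> M; rewrite !inE orbA.
Qed.

(** [A *m A^T] is its own transpose, which forces equal coefficients on [A] and [A^T], because rank
    3 keeps these two matrices distinct. *)
Lemma scheme3_mulT : exists k b : R, A *m A^T = k%:M + b *: (A + A^T).
Proof.
have : A *m A^T \in <<[fset 1%:M; A; A^T]>>%VS.
  by apply: (assoc_scheme_mul schA); rewrite !inE eqxx !orbT.
case/span_fset3P => a [b [c AAT]].
exists a, b; rewrite AAT.
have /eqP: (b - c) *: (A - A^T) = 0.
  have := congr1 trmx AAT; rewrite trmx_mul trmxK AAT !linearD !linearZ /= trmx1 trmxK.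
  by move=> /eqP; rewrite -subr_eq0 => /eqP <-; apply/matrixP => i j; rewrite !mxE; ring.
rewrite scaler_eq0 !subr_eq0 => /orP[/eqP->|/eqP eqA].
  by rewrite scalerDr scalemx1 addrA.
have := cardfs3_uniq rankA; rewrite /= !inE -eqA eqxx !andbF //.
Qed.

Lemma scheme3_params : exists k b : R,
  [/\ m%:R = 2 * k + 1, k = 2 * b + 1,
      forall p, A *m (const_mx 1 : 'M_(m, p)) = const_mx k,
      forall p, (const_mx 1 : 'M_(p, m)) *m A = const_mx k
    & A *m A^T = k%:M + b *: (A + A^T)].
Proof.
have [k [b AAT]] := scheme3_mulT; exists k, b.
have entry := tournament_entry scheme3_01 scheme3_tournament.
have diag := tournament_diag scheme3_01 scheme3_tournament.
have rowA p : A *m (const_mx 1 : 'M_(m, p)) = const_mx k.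
  apply/matrixP => i j; rewrite !mxE.
  (* Since the entries are 0 or 1, the sum of squares along row [i] is the row sum; the zero
     diagonal of [A] leaves only [k] on the right. *)
  have := congr1 (fun M : 'M_m => M i i) AAT; rewrite !mxE eqxx !diag.
  rewrite addr0 mulr0 addr0 mulr1n => <-; apply: eq_bigr => l _; rewrite !mxE.
  have := entry i l; rewrite !inE !xpair_eqE => /or3P[] /andP[/andP[_ /eqP->] _]; ring.
have colAT p : (const_mx 1 : 'M_(p, m)) *m A^T = const_mx k.
  by apply: trmx_inj; rewrite trmx_mul trmxK !trmx_const rowA.
have A_neq0 : A != 0 by apply: (assoc_scheme_neq0 schA); rewrite !inE eqxx orbT.
have m_neq0 : m%:R != 0 :> R.
  rewrite pnatr_eq0; apply: contraNT A_neq0 => /negPn m0.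
  by apply/eqP/matrixP => i; have := ltn_ord i; rewrite {2}(eqP m0).
have AE : A = const_mx 1 - 1%:M - A^T.
  by rewrite -scheme3_tournament; apply/matrixP => i j; rewrite !mxE; ring.
have colA0 p : (const_mx 1 : 'M_(p, m)) *m A = const_mx (m%:R - 1 - k).
  rewrite AE !mulmxBr mulmx_ones mulmx1 colAT.
  by apply/matrixP => i j; rewrite !mxE.
have i0 : 'I_m by case: (m) m_neq0 => [|n]; [rewrite eqxx | exists 0%N].
(* Summing all entries of [A] by columns and by rows gives [m * (m - 1 - k) = m * k]. *)
have mk : m%:R - 1 - k = k.
  have : (const_mx 1 : 'rV_m) *m A *m (const_mx 1 : 'cV_m) = 
         (const_mx 1 : 'rV_m) *m (A *m (const_mx 1 : 'cV_m)) by rewrite mulmxA.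
  have cc (a : R) p q : const_mx a = a *: const_mx 1 :> 'M_(p, q).
    by apply/matrixP => i j; rewrite !mxE mulr1.
  rewrite colA0 rowA (cc (_ - _)) (cc k) -scalemxAl -scalemxAr mulmx_ones.
  move=> /matrixP/(_ 0 0); rewrite !mxE; exact: mulIf.
have mE : m%:R = 2 * k + 1.
  by transitivity (m%:R - 1 - k + k + 1); [ring | rewrite mk; ring].
have colA p : (const_mx 1 : 'M_(p, m)) *m A = const_mx k by rewrite colA0 mk.
split=> //.
(* On the all-ones vector the identity reads [k * k = k + 2 * b * k], from which [k] is
   cancelled. *)
have := congr1 (fun M => M *m (const_mx 1 : 'cV[R]_m)) AAT.
rewrite -mulmxA mulmxDl mul_scalar_mx -scalemxAl mulmxDl rowA.
have rowAT : A^T *m (const_mx 1 : 'cV_m) = const_mx k.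
  by apply: trmx_inj; rewrite trmx_mul trmxK !trmx_const colA.
rewrite rowAT.
have cc (a : R) : const_mx a = a *: const_mx 1 :> 'cV_m.
  by apply/matrixP => i j; rewrite !mxE mulr1.
rewrite (cc k) -scalemxAr rowA.
move=> /matrixP/(_ i0 0); rewrite !mxE => kk.
(* If [k = 0] then [m = 1], and the zero diagonal makes [A] vanish. *)
have k_neq0 : k != 0.
  apply: contraNneq A_neq0 => k0.
  have m1 : m = 1%N by apply/eqP; rewrite -(eqr_nat R) mE k0 mulr0 add0r.
  apply/eqP/matrixP => i j; rewrite mxE.
  suff -> : i = j by apply: diag.
  case: i j => [i lti] [j ltj]; apply: val_inj => /=.
  by move: lti ltj; rewrite m1; case: i j => [|i] [|j].
apply: (mulfI k_neq0); rewrite kk; ring.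
Qed.

End IntersectionNumbers.

(** * The dihedral group of order 8 *)

Lemma commute_gen2 (gT : finGroupType) (a b c g : gT) :
  commute c a -> commute c b -> g \in <<[set a; b]>>%g -> commute c g.
Proof.
move=> ca cb; have /subsetP sub : (<<[set a; b]>> \subset 'C[c])%g.
  by rewrite gen_subG; apply/subsetP => _ /set2P[] ->; apply/cent1P.
by move=> /sub/cent1P.
Qed.

Section Dihedral.
Local Open Scope group_scope.

Variables (gT : finGroupType) (a b z : gT).
Hypotheses (a4 : a ^+ 4 = 1) (b2 : b ^+ 2 = 1) (ba : b * a = a ^+ 3 * b).
Hypothesis a2_neq1 : a ^+ 2 != 1.
Hypothesis zE : z = a ^+ 2.

Let G := <<[set a; b]>>%G.
Let H := 'C_G[b]%G.

Let HE h : (h \in H) = (h \in [:: 1; z; b; z * b]).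
Proof. by rewrite zE; case: (dihedral_cent1 a4 b2 ba a2_neq1 h). Qed.

Let GDE g : (g \in G :\: H) = (g \in [:: a; a ^+ 3; a * b; a ^+ 3 * b]).
Proof. by case: (dihedral_cent1 a4 b2 ba a2_neq1 g). Qed.

Lemma dihedral_bb : b * b = 1. Proof. by rewrite -b2 expgS expg1. Qed.

Lemma dihedral_zz : z * z = 1. Proof. by rewrite zE -expgD a4. Qed.

Lemma dihedral_zH : z \in H. Proof. by rewrite HE !inE eqxx orbT. Qed.

Lemma dihedral_bH : b \in H. Proof. by rewrite HE !inE eqxx !orbT. Qed.

Lemma dihedral_aGD : a \in G :\: H. Proof. by rewrite GDE !inE eqxx. Qed.

Lemma dihedral_H_commute h : h \in H -> b * h = h * b.
Proof. by case/setIP => _ /cent1P/commute_sym. Qed.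

Lemma dihedral_HG h : h \in H -> h \in G.
Proof. by case/setIP. Qed.

Lemma dihedral_z_central g : g \in G -> z * g = g * z.
Proof.
apply: commute_gen2; first by rewrite zE; apply/commute_sym/commuteX.
exact/commute_sym/dihedral_H_commute/dihedral_zH.
Qed.

(** The elements outside [H] are the [a * h] with [h] in [H]; the relation [b * a = a * z * b]
    extends to them because [h] commutes with both [b] and [z]. *)
Lemma dihedral_anticommute g : g \in G :\: H -> b * g = g * z * b.
Proof.
have a3 : a ^+ 3 = a * z by rewrite zE -expgS.
have ba_ : b * a = a * z * b by rewrite ba a3.
have xH h : h \in H -> b * (a * h) = a * h * z * b.
  move=> hH; rewrite mulgA ba_ -!mulgA (dihedral_H_commute hH); congr (_ * _).
  by rewrite !mulgA (dihedral_z_central (dihedral_HG hH)).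
rewrite GDE a3 -!mulgA mem_seq4 => /or4P[] /eqP->.
- by rewrite ba_ !mulgA.
- by rewrite xH ?dihedral_zH // !mulgA.
- by rewrite xH ?dihedral_bH // !mulgA.
- by rewrite xH ?groupM ?dihedral_zH ?dihedral_bH // !mulgA.
Qed.

Lemma dihedral_HGD h g : h \in H -> g \in G :\: H -> h * g \in G :\: H.
Proof.
move=> hH /setDP[gG ngH].
by rewrite in_setD groupMl // ngH groupM // dihedral_HG.
Qed.

Lemma dihedral_GDH h g : h \in H -> g \in G :\: H -> g * h \in G :\: H.
Proof.
move=> hH /setDP[gG ngH].
by rewrite in_setD groupMr // ngH groupM // dihedral_HG.
Qed.

Lemma dihedral_GDV g : g \in G :\: H -> g^-1 \in G :\: H.
Proof. by rewrite !in_setD !groupV. Qed.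

(** Moving [b] past the two factors creates [z] twice, and [z * z = 1]. *)
Lemma dihedral_GDGD g g' : g \in G :\: H -> g' \in G :\: H -> g * g' \in H.
Proof.
move=> gD g'D; have [[gG _] [g'G _]] := (setDP gD, setDP g'D).
rewrite in_setI groupM //=; apply/cent1P; rewrite /commute [in RHS]mulgA.
rewrite (dihedral_anticommute gD) -!mulgA (dihedral_anticommute g'D) !mulgA.
by rewrite -(mulgA g z) (dihedral_z_central g'G) -!mulgA (mulgA z z) dihedral_zz mul1g.
Qed.

(** Expanding a product of two [mu] gives nine terms; these are the group parts of the six whose
    left factor is not [g] alone. Each follows by moving [b] past [g'], at the cost of one central
    [z]. *)
Lemma dihedral_mul_rules g g' : g \in G :\: H -> g' \in G :\: H ->
  [/\ g * b * g' = g * g' * z * b, g * b * (g' * b) = g * g' * z,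
      g * b * (g' * z * b) = g * g', g * z * b * g' = g * g' * b
    & g * z * b * (g' * b) = g * g' /\ g * z * b * (g' * z * b) = g * g' * z].
Proof.
move=> gD g'D; have [g'G _] := setDP g'D.
have bg' := dihedral_anticommute g'D; have zg' := dihedral_z_central g'G.
have zb : z * b = b * z by rewrite dihedral_H_commute ?dihedral_zH.
have e1 : g * b * g' = g * g' * z * b by rewrite -mulgA bg' !mulgA.
have e2 : g * z * b * g' = g * g' * b.
  by rewrite -mulgA bg' -!mulgA (mulgA z g') zg' -!mulgA (mulgA z z) dihedral_zz mul1g.
split=> //; last split.
- by rewrite mulgA e1 -mulgA dihedral_bb mulg1.
- rewrite !mulgA e1 -mulgA zb !mulgA -(mulgA _ b b) dihedral_bb mulg1.
  by rewrite -mulgA dihedral_zz mulg1.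
- by rewrite mulgA e2 -mulgA dihedral_bb mulg1.
- by rewrite !mulgA e2 -mulgA zb mulgA -(mulgA _ b b) dihedral_bb mulg1.
Qed.

(** Inversion exchanges the types [g * b] and [g * z * b], just as transposition exchanges [A] and
    [A^T]. *)
Lemma dihedral_inv_rules g : g \in G :\: H ->
  (g * b)^-1 = g^-1 * z * b /\ (g * z * b)^-1 = g^-1 * b.
Proof.
move=> gD; have bV : b^-1 = b by apply/eqP; rewrite eq_invg_mul dihedral_bb.
have zV : z^-1 = z by apply/eqP; rewrite eq_invg_mul dihedral_zz.
have zb : z * b = b * z by rewrite dihedral_H_commute ?dihedral_zH.
have gV := dihedral_anticommute (dihedral_GDV gD).
rewrite !invMg bV zV gV; split=> //.
have [gG _] := setDP (dihedral_GDV gD).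
rewrite dihedral_z_central // mulgA gV -mulgA -zb mulgA -(mulgA _ z z).
by rewrite dihedral_zz mulg1.
Qed.

End Dihedral.

(** * Permutation matrices and Kronecker products *)

Section PermMx.
Variable R : pzSemiRingType.

(** Both sides are the adjacency matrix of the 4-cycle: [gy] and [gx ^+ 2 * gy] are its two perfect
    matchings, [gx] and [gx ^+ 3] its two unit rotations. *)
Lemma perm_mx_gyx2y :
  perm_mx gy + perm_mx (gx ^+ 2 * gy) = perm_mx gx + perm_mx (gx ^+ 3) :> 'M[R]_4.
Proof.
apply/matrixP => i j; rewrite !mxE -!val_eqE (permM (gx ^+ 2)%g gy).
rewrite (permX gx i 2) (permX gx i 3) /= ?gyE ?gxE.
by case: i => [[|[|[|[|//]]]] ?]; case: j => [[|[|[|[|//]]]] ?] /=; rewrite ?addr0 ?add0r.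
Qed.

(** [groupH] acts regularly on the four points, so each entry is hit by exactly one summand. *)
Lemma perm_mx_sumH :
  perm_mx 1 + perm_mx (gx ^+ 2) + (perm_mx gy + perm_mx (gx ^+ 2 * gy)) =
  const_mx 1 :> 'M[R]_4.
Proof.
apply/matrixP => i j; rewrite !mxE -!val_eqE (permM (gx ^+ 2)%g gy) perm1.
rewrite (permX gx i 2) /= ?gyE ?gxE.
by case: i => [[|[|[|[|//]]]] ?]; case: j => [[|[|[|[|//]]]] ?] /=; rewrite ?addr0 ?add0r.
Qed.

End PermMx.

Lemma tens_perm_mxM (R : comPzRingType) n p (M N : 'M[R]_n) (s t : 'S_p) :
  tensmx M (perm_mx s) *m tensmx N (perm_mx t) =
  tensmx (M *m N) (perm_mx (s * t)%g).
Proof. by rewrite tensmx_mul -perm_mxM. Qed.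

Lemma tensmxDl (R : pzRingType) m n p q (M N : 'M[R]_(m, n)) (P : 'M_(p, q)) :
  tensmx (M + N) P = tensmx M P + tensmx N P.
Proof. by apply/matrixP => i j; rewrite !mxE mulrDl. Qed.

Lemma tensmxDr (R : pzRingType) m n p q (M : 'M[R]_(m, n)) (P Q : 'M_(p, q)) :
  tensmx M (P + Q) = tensmx M P + tensmx M Q.
Proof. by apply/matrixP => i j; rewrite !mxE mulrDr. Qed.

Lemma tensmxZl (R : pzRingType) m n p q c (M : 'M[R]_(m, n)) (P : 'M_(p, q)) :
  tensmx (c *: M) P = c *: tensmx M P.
Proof. by apply/matrixP => i j; rewrite !mxE mulrA. Qed.

(** * Identities between the blocks [E], [A1], [A2] *)

Section Blocks.

Variables (R : numFieldType) (m : nat) (A : 'M[R]_m) (k b : R).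
Hypothesis A_tournament : 1%:M + A + A^T = const_mx 1.
Hypothesis mE : m%:R = 2 * k + 1.
Hypothesis kE : k = 2 * b + 1.
Hypothesis rowA : forall p, A *m (const_mx 1 : 'M_(m, p)) = const_mx k.
Hypothesis colA : forall p, (const_mx 1 : 'M_(p, m)) *m A = const_mx k.
Hypothesis AAT : A *m A^T = k%:M + b *: (A + A^T).

Let E := Emx R m.
Let A1 := tildemx A.
Let A2 := tildemx A^T.

Let rowAT p : A^T *m (const_mx 1 : 'M_(m, p)) = const_mx k.
Proof. by apply: trmx_inj; rewrite trmx_mul trmxK !trmx_const colA. Qed.

Let colAT p : (const_mx 1 : 'M_(p, m)) *m A^T = const_mx k.
Proof. by apply: trmx_inj; rewrite trmx_mul trmxK !trmx_const rowA. Qed.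

Let AJ : A *m A + A *m A^T = const_mx k - A.
Proof.
rewrite -mulmxDr -(rowA m) -A_tournament !mulmxDr mulmx1.
by apply/matrixP => i j; rewrite !mxE; ring.
Qed.

Let JA : A *m A + A^T *m A = const_mx k - A.
Proof.
rewrite -mulmxDl -(colA m) -A_tournament !mulmxDl mul1mx.
by apply/matrixP => i j; rewrite !mxE; ring.
Qed.

(** [AJ] and [JA] have the same right-hand side, so [A] commutes with [A^T]. *)
Let ATA : A^T *m A = k%:M + b *: (A + A^T).
Proof. by rewrite -AAT; apply: (addrI (A *m A)); rewrite AJ. Qed.

Let AA : A *m A = const_mx k - A - (k%:M + b *: (A + A^T)).
Proof. by rewrite -AJ AAT addrK. Qed.

Let ATAT : A^T *m A^T = const_mx k - A^T - (k%:M + b *: (A + A^T)).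
Proof.
by rewrite -trmx_mul AA; apply/matrixP => i j; rewrite !mxE eq_sym; ring.
Qed.

(** These two products are paired because both carry the group element [g * g' * gy] in a product of
    two [mu]; those of [mul_E_tildeT] carry [g * g' * gx ^+ 2 * gy]. *)
Lemma mul_E_tilde : E *m A1 + A2 *m E = k *: E.
Proof.
rewrite /E /A1 /A2 /Emx /tildemx !mulmx_block !(mul0mx, mulmx0, add0r, addr0).
by rewrite colA rowAT add_block_mx scale_block_mx;
  congr block_mx; apply/matrixP => i j; rewrite !mxE; ring.
Qed.

Lemma mul_E_tildeT : E *m A2 + A1 *m E = k *: E.
Proof.
rewrite /E /A1 /A2 /Emx /tildemx !mulmx_block !(mul0mx, mulmx0, add0r, addr0).
by rewrite colAT rowA add_block_mx scale_block_mx;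
  congr block_mx; apply/matrixP => i j; rewrite !mxE; ring.
Qed.

(** The coefficient of [g * g' * gx ^+ 2]. Writing J for the all-ones matrix, J - I = [A + A^T]
    gives the factor [2 * k - 1 - 2 * b = k]. *)
Lemma sqr_tilde : A1 *m A1 + A2 *m A2 = k *: (A1 + A2).
Proof.
rewrite /A1 /A2 /tildemx !mulmx_block !(mul0mx, mulmx0, add0r, addr0).
rewrite !add_block_mx scale_block_mx !addr0 !scaler0; congr block_mx.
rewrite AA ATAT; apply/matrixP => i j.
have := congr1 (fun M : 'M_m => M i j) A_tournament; rewrite !mxE kE => J1.
have -> : A i j = 1 - (i == j)%:R - A j i by rewrite -{1}J1; ring.
by case: (i == j) => /=; ring.
Qed.

(** The coefficient of [g * g']. Its lower right block is J + 2kI + 2b([A + A^T]), where J = I +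
    [A + A^T], [2 * k + 1 = m] and [2 * b + 1 = k]. *)
Lemma sqr_E_tilde : E *m E + A1 *m A2 + A2 *m A1 = m%:R%:M + k *: (A1 + A2).
Proof.
rewrite /E /Emx /A1 /A2 /tildemx !mulmx_block !(mul0mx, mulmx0, add0r, addr0).
rewrite !add_block_mx scale_block_mx !addr0 !mulmx_ones AAT ATA.
rewrite scalar_mx_block add_block_mx !scaler0 !addr0.
congr block_mx; apply/matrixP => i j; rewrite !mxE.
  by rewrite ord1 [j]ord1 eqxx mulr1n.
have := congr1 (fun M : 'M_m => M i j) A_tournament; rewrite !mxE => J1.
have -> : A i j + A j i = 1 - (i == j)%:R by rewrite -{1}J1; ring.
by rewrite mE kE; case: (i == j) => /=; ring.
Qed.

Lemma sum_tilde : 1%:M + E + A1 + A2 = const_mx 1.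
Proof.
rewrite /E /Emx /A1 /A2 /tildemx scalar_mx_block.
rewrite !add_block_mx !addr0 !add0r -block_mx_const.
rewrite A_tournament; congr block_mx; apply/matrixP => i j; rewrite !mxE.
by rewrite ord1 [j]ord1 eqxx.
Qed.

End Blocks.

(** * Pairs of [mu] whose sum has the group algebra form *)

Section MuProduct.
Variables (R : numFieldType) (m : nat) (A : 'M[R]_m).
Let E := Emx R m.
Let A1 := tildemx A.
Let A2 := tildemx A^T.

Lemma perm_mx_mul_gx (h : 'S_4) :
  perm_mx (h * gx) + perm_mx (h * gx ^+ 3) =
  perm_mx (h * gy) + perm_mx (h * gx ^+ 2 * gy) :> 'M[R]_4.
Proof.
by rewrite -(mulgA h _ gy) !(perm_mxM _ h) -!mulmxDr perm_mx_gyx2y.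
Qed.

Lemma perm_mx_mul_gxgy (h : 'S_4) :
  perm_mx (h * gx * gy) + perm_mx (h * gx ^+ 3 * gy) =
  perm_mx h + perm_mx (h * gx ^+ 2) :> 'M[R]_4.
Proof.
rewrite [LHS](_ : _ = (perm_mx (h * gx) + perm_mx (h * gx ^+ 3)%g) *m perm_mx gy).
  rewrite perm_mx_mul_gx mulmxDl -!perm_mxM.
  by rewrite -(mulgA h gy gy) -(mulgA _ gy gy) (dihedral_bb gy2) !mulg1.
by rewrite mulmxDl -!perm_mxM.
Qed.

(** Multiplication by [gx ^+ 2] exchanges [h * gx] and [h * gx ^+ 3], so [A1] and [A2] each meet
    both [h * gx * gy] and [h * gx ^+ 3 * gy], and [perm_mx_mul_gxgy] applies to their common
    sum. *)
Lemma mu_add_gx (h : 'S_4) :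
  mu A A^T (h * gx) + mu A A^T (h * gx ^+ 3)
  = tensmx (A1 + A2) (perm_mx h) + tensmx (A1 + A2) (perm_mx (h * gx ^+ 2)%g)
    + (tensmx E (perm_mx (h * gy)%g) + tensmx E (perm_mx (h * gx ^+ 2 * gy)%g)).
Proof.
rewrite -!tensmxDr -perm_mx_mul_gx -perm_mx_mul_gxgy /mu.
have -> : (h * gx * gx ^+ 2 = h * gx ^+ 3)%g by rewrite -mulgA -expgS.
have -> : (h * gx ^+ 3 * gx ^+ 2 = h * gx)%g.
  by rewrite -mulgA -expgD (expgD _ 4 1) gx4 mul1g.
rewrite tensmxDl !tensmxDr -/E -/A1 -/A2.
by apply/matrixP => i j; rewrite ![in LHS]mxE ![in RHS]mxE; ring.
Qed.

End MuProduct.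

(** * Products, transposes and total sum of the [sigma] and [mu] *)

Section SchemeD.
Variables (R : numFieldType) (m : nat) (A : 'M[R]_m).
Hypothesis schA : assoc_scheme [fset 1%:M; A; A^T].
Hypothesis rankA : scheme_rank [fset 1%:M; A; A^T] = 3%N.

Let A_tournament := scheme3_tournament schA rankA.
Let muA := mu A A^T.
Let E := Emx R m.
Let A1 := tildemx A.
Let A2 := tildemx A^T.
Let GD := (groupG :\: groupH)%SET.

Lemma sigma_mul (h h' : 'S_4) : sigma R m h *m sigma R m h' = sigma R m (h * h')%g.
Proof. by rewrite tens_perm_mxM mul1mx. Qed.

Lemma sigma_mu (h g : 'S_4) : sigma R m h *m muA g = muA (h * g)%g.
Proof. by rewrite !mulmxDr !tens_perm_mxM !mul1mx !(mulgA h). Qed.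

(** Elements of [groupH] commute with [gy] and [gx ^+ 2], so [h] can be moved to the left of
    both. *)
Lemma mu_sigma (g h : 'S_4) : h \in groupH -> muA g *m sigma R m h = muA (g * h)%g.
Proof.
move=> hH; rewrite !mulmxDl !tens_perm_mxM !mulmx1.
have yh : (gy * h = h * gy)%g := dihedral_H_commute hH.
have zh : (gx ^+ 2 * h = h * gx ^+ 2)%g.
  apply: (dihedral_z_central gx4 gy2 gyx gx2_neq1 (erefl _)).
  exact: dihedral_HG hH.
have zyh : (gx ^+ 2 * gy * h = h * (gx ^+ 2 * gy))%g.
  by rewrite -mulgA yh (mulgA _ h) zh -(mulgA h).
rewrite -(mulgA g gy h) yh -(mulgA g _ gy) -(mulgA g _ h) zyh.
by rewrite !(mulgA g h) (mulgA _ _ gy).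
Qed.

Lemma mu_mul : exists k : R, forall g g' : 'S_4, g \in GD -> g' \in GD ->
  muA g *m muA g' = m%:R *: sigma R m (g * g')%g
    + k *: (muA (g * g' * gx)%g + muA (g * g' * gx ^+ 3)%g).
Proof.
have [k [b [mE kE rowA colA AAT]]] := scheme3_params schA rankA.
exists k => g g' gD g'D.
have [r1 r2 r3 r4 [r5 r6]] :=
  dihedral_mul_rules gx4 gy2 gyx gx2_neq1 (erefl _) gD g'D.
rewrite mu_add_gx /muA /mu !mulmxDl !mulmxDr !tens_perm_mxM r1 r2 r3 r4 r5 r6.
rewrite (mulgA g g' gy) (mulgA g _ gy) (mulgA g g' (gx ^+ 2)%g).
move: (g * g')%g => h.
rewrite /sigma -/E -/A1 -/A2 -tensmxZl.
(* The coefficients on the right are traded for the block products occurring on the left; the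
   entrywise comparison then becomes a ring identity. *)
have -> : m%:R *: 1%:M =
    E *m E + A1 *m A2 + A2 *m A1 + (-1) *: (A1 *m A1 + A2 *m A2).
  rewrite (sqr_E_tilde A_tournament mE kE rowA colA AAT).
  by rewrite (sqr_tilde A_tournament kE rowA AAT) scaleN1r addrK scalemx1.
set F := A1 + A2; rewrite !scalerDr -!tensmxZl.
rewrite [k *: F](_ : _ = A1 *m A1 + A2 *m A2); last first.
  by rewrite (sqr_tilde A_tournament kE rowA AAT).
(* The first [k *: E] belongs to [h * gy] and the second to [h * gx ^+ 2 * gy], hence the two
   different expansions. *)
rewrite -{1}(mul_E_tilde colA) -(mul_E_tildeT rowA) -/E -/A1 -/A2 !(tensmxDl, tensmxZl).
apply/matrixP => i j; rewrite ![in LHS]mxE ![in RHS]mxE; ring.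
Qed.

Lemma sigma_tr (h : 'S_4) : (sigma R m h)^T = sigma R m h^-1.
Proof. by rewrite trmx_tens trmx1 tr_perm_mx. Qed.

(** Transposition exchanges the last two terms of [mu] twice over, once in the block factor and once
    in the group factor. *)
Lemma mu_tr (g : 'S_4) : g \in GD -> (muA g)^T = muA g^-1.
Proof.
move=> gD; have [i1 i2] := dihedral_inv_rules gx4 gy2 gyx gx2_neq1 (erefl _) gD.
rewrite !linearD /= !trmx_tens !tr_perm_mx i1 i2 /tildemx.
rewrite !tr_block_mx !trmx0 !trmx_const trmxK.
by rewrite addrAC.
Qed.

(** An explicit enumeration of [schemeD], over which the sum can be unfolded. *)
Let schemeD_seq :=
  [seq sigma R m h | h <- [:: 1; gx ^+ 2; gy; gx ^+ 2 * gy]%g]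
  ++ [seq muA g | g <- [:: gx; gx ^+ 3; gx * gy; gx ^+ 3 * gy]%g].

(** [mu_add_gx] at [1] and at [gy] covers all four [mu], and adds up to [E + A1 + A2] tensored with
    the sum over [groupH]; the [sigma] supply the identity block. *)
Lemma sum_schemeD_seq : \sum_(M <- schemeD_seq) M = const_mx 1.
Proof.
have zy : (gy * gx ^+ 2 = gx ^+ 2 * gy)%g.
  exact: dihedral_H_commute (dihedral_zH gx4 gy2 gyx gx2_neq1 (erefl _)).
have mu1 := mu_add_gx A 1; have muy := mu_add_gx A gy.
have yx3 : (gy * gx ^+ 3 = gx * gy)%g.
  rewrite (dihedral_anticommute gx4 gy2 gyx gx2_neq1 (erefl _)).
    by rewrite -expgD (expgD _ 4 1) gx4 mul1g.
  by rewrite groupGDHE !inE eqxx orbT.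
rewrite gyx yx3 zy -(mulgA _ gy gy) (dihedral_bb gy2) mulg1 in muy.
rewrite !mul1g in mu1.
rewrite /schemeD_seq big_cat /= !big_cons !big_nil !addr0 /muA.
rewrite [X in _ + X]addrA mu1.
rewrite [X in _ + (_ + X)]addrC muy.
transitivity (tensmx (1%:M + E + A1 + A2) (const_mx 1 : 'M[R]_4)).
  rewrite -perm_mx_sumH !(tensmxDl, tensmxDr) /sigma -/E -/A1 -/A2.
  by apply/matrixP => i j; rewrite ![in LHS]mxE ![in RHS]mxE; ring.
by rewrite sum_tilde //; apply/matrixP => i j; rewrite !mxE mulr1.
Qed.

(** * Distinctness, non-vanishing and 0/1 entries *)

Let u0 : 'I_(1 + m) := lshift m 0.

(** The border index [u0] makes the permutation visible: in its diagonal block for [sigma], where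
    [mu] vanishes, and in the blocks to the right of it for [mu]. *)
Lemma sigma_ul (h : 'S_4) k l :
  sigma R m h (mxtens_index (u0, k)) (mxtens_index (u0, l)) = (h k == l)%:R.
Proof. by rewrite tensmxE !mxE eqxx mul1r. Qed.

Lemma mu_ul (g : 'S_4) k l :
  muA g (mxtens_index (u0, k)) (mxtens_index (u0, l)) = 0.
Proof.
by rewrite mxE [X in X + _]mxE !tensmxE !block_mxEul !mxE !mul0r !addr0.
Qed.

Lemma mu_ur (g : 'S_4) k l (i : 'I_m) :
  muA g (mxtens_index (u0, k)) (mxtens_index (rshift 1 i, l)) = (g k == l)%:R.
Proof.
rewrite mxE [X in X + _]mxE !tensmxE !block_mxEur.
by rewrite !mxE !mul0r !addr0 mul1r.
Qed.

Let sigma_inj : injective (sigma R m).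
Proof.
move=> s t st; apply/permP => k; apply/eqP.
have := sigma_ul s k (t k); rewrite st sigma_ul eqxx.
by case: (s k == t k) => // /eqP; rewrite oner_eq0.
Qed.

(** A column outside the border, needed to apply [mu_ur]; it exists since [A] is non-zero. *)
Let i0 : 'I_m.
Proof.
have A_neq0 : A != 0 by apply: (assoc_scheme_neq0 schA); rewrite !inE eqxx orbT.
case: (m) A A_neq0 => [A' /eqP[]|n _ _]; last exact: ord0.
by apply/matrixP => -[].
Qed.

Let mu_inj : injective muA.
Proof.
move=> s t st; apply/permP => k; apply/eqP.
have := mu_ur s k (t k) i0; rewrite st mu_ur eqxx.
by case: (s k == t k) => // /eqP; rewrite oner_eq0.
Qed.

Let sigma_neq_mu h g : sigma R m h <> muA g.
Proof.
move=> hg; have := sigma_ul h 0 (h 0); rewrite hg mu_ul eqxx => /esym/eqP.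
by rewrite oner_eq0.
Qed.

Let mu_neq0 g : muA g != 0.
Proof.
apply/eqP => g0; have := mu_ur g 0 (g 0) i0; rewrite g0 mxE eqxx => /esym/eqP.
by rewrite oner_eq0.
Qed.

Let sigma_neq0 h : sigma R m h != 0.
Proof.
apply/eqP => g0; have := sigma_ul h 0 (h 0); rewrite g0 mxE eqxx => /esym/eqP.
by rewrite oner_eq0.
Qed.

Let bool01 (c : bool) : (c%:R == 0 :> R) || (c%:R == 1 :> R).
Proof. by case: c; rewrite eqxx ?orbT. Qed.

Let sigma_01 h : is01mx (sigma R m h).
Proof.
apply/forallP => i; apply/forallP => j; rewrite !mxE -natrM mulnb; exact: bool01.
Qed.

(** The three blocks have disjoint supports, so at most one term of [mu] contributes to any
    entry. *)
Let block_entry i j : (E i j, A1 i j, A2 i j) \in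
  [:: (0, 0, 0); (1, 0, 0); (0, 1, 0); (0, 0, 1)].
Proof.
rewrite /E /A1 /A2 /Emx /tildemx.
case: (split_ordP i) => {}i ->; case: (split_ordP j) => {}j ->;
  rewrite !(block_mxEul, block_mxEur, block_mxEdl, block_mxEdr) !mxE ?inE ?eqxx ?orbT //.
have := tournament_entry (scheme3_01 schA) A_tournament i j.
by rewrite !inE !xpair_eqE => /or3P[] /andP[/andP[_ /eqP->] /eqP->]; rewrite !eqxx ?orbT.
Qed.

Let mu_01 g : is01mx (muA g).
Proof.
apply/forallP => i; apply/forallP => j.
case: (mxtens_indexP i) => {}i k; case: (mxtens_indexP j) => {}j l.
rewrite mxE [X in X + _]mxE !tensmxE ![perm_mx _ _ _]mxE ![1%:M _ _]mxE.
have := block_entry i j; rewrite /E /A1 /A2 !inE !xpair_eqE.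
case/or4P => /andP[/andP[/eqP-> /eqP->] /eqP->];
  rewrite !(mul0r, mul1r, add0r, addr0) ?eqxx //; exact: bool01.
Qed.

Lemma mem_schemeD M : (M \in schemeD A A^T) = (M \in schemeD_seq).
Proof.
rewrite in_fsetU mem_cat; congr (_ || _).
  by apply/imfsetP/mapP => -[h hH ->]; exists h => //; move: hH; rewrite /= groupHE.
by apply/imfsetP/mapP => -[g gD ->]; exists g => //; move: gD; rewrite /= groupGDHE.
Qed.

Lemma uniq_schemeD_seq : uniq schemeD_seq.
Proof.
(* The image of 0 already separates the four permutations within each half of the list. *)
have by_image0 (s : seq 'S_4) : uniq [seq val ((g : 'S_4) 0) | g <- s] -> uniq s.
  exact: map_uniq.
have gx20 : (gx ^+ 2)%g 0 = 2%N :> nat by rewrite (permX gx _ 2) /= !gxE.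
have gx30 : (gx ^+ 3)%g 0 = 3%N :> nat by rewrite (permX gx _ 3) /= !gxE.
rewrite cat_uniq (map_inj_uniq sigma_inj) (map_inj_uniq mu_inj).
apply/and3P; split.
- by apply: by_image0; rewrite /= perm1 (permM (gx ^+ 2)%g gy) !gyE gx20.
- apply/hasPn => _ /mapP[g _ ->]; apply/mapP => -[h _ /esym].
  exact: sigma_neq_mu.
- by apply: by_image0; rewrite /= (permM gx gy) (permM (gx ^+ 3)%g gy) !gyE gx30 !gxE.
Qed.

Let sigma_in h : h \in groupH -> sigma R m h \in schemeD A A^T.
Proof. by move=> hH; rewrite in_fsetU in_imfset. Qed.

Let mu_in g : g \in GD -> muA g \in schemeD A A^T.
Proof. by move=> gD; rewrite in_fsetU orbC in_imfset. Qed.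

Let schemeD_case M : M \in schemeD A A^T ->
  (exists2 h, h \in groupH & M = sigma R m h) \/ (exists2 g, g \in GD & M = muA g).
Proof.
by case/fsetUP => /imfsetP[g gG ->]; [left | right]; exists g.
Qed.

(** * The axioms of an association scheme *)

Lemma schemeD_assoc : assoc_scheme (schemeD A A^T).
Proof.
have [k mumu] := mu_mul.
split.
- by move=> _ /schemeD_case[] [g gG ->].
- by move=> _ /schemeD_case[] [g gG ->].
- rewrite -[1%:M](_ : sigma R m 1 = _); first exact: sigma_in.
  apply/matrixP => i j.
  case: (mxtens_indexP i) => {}i k'; case: (mxtens_indexP j) => {}j l.
  by rewrite tensmxE !mxE perm1 -natrM mulnb (can_eq (@mxtens_indexK _ _)) xpair_eqE.
- rewrite -sum_schemeD_seq; apply/perm_big/uniq_perm.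
  + exact: fset_uniq.
  + exact: uniq_schemeD_seq.
  + exact: mem_schemeD.
- move=> _ /schemeD_case[] [g gG ->]; apply: memv_span.
    by rewrite sigma_tr sigma_in // groupV.
  by rewrite mu_tr // mu_in // (dihedral_GDV gG).
- move=> _ _ /schemeD_case[] [g gG ->] /schemeD_case[] [g' g'G ->].
  + by rewrite sigma_mul memv_span // sigma_in // groupM.
  + by rewrite sigma_mu memv_span // mu_in // (dihedral_HGD gG g'G).
  + by rewrite mu_sigma // memv_span // mu_in // (dihedral_GDH g'G gG).
  (* As [g * g'] lies in [groupH], its products with [gx] and [gx ^+ 3] fall back into [GD], so all
     three matrices in [mumu] belong to the scheme. *)
  have ggH := dihedral_GDGD gx4 gy2 gyx gx2_neq1 (erefl _) gG g'G.
  have xGD : gx \in GD := dihedral_aGD gx4 gy2 gyx gx2_neq1.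
  have x3GD : (gx ^+ 3)%g \in GD by rewrite groupGDHE !inE eqxx orbT.
  have ggx := dihedral_HGD ggH xGD; have ggx3 := dihedral_HGD ggH x3GD.
  rewrite mumu //; apply: memvD; apply: memvZ; first exact/memv_span/sigma_in.
  by apply: memvD; apply/memv_span/mu_in.
Qed.

End SchemeD.

Theorem theorem3p6 (R : numFieldType) (m : nat) (A0 A1 A2 : 'M[R]_m)
    (hA0 : A0 = 1%:M)
    (hA2 : A2 = A1^T)
    (hscheme : assoc_scheme [fset A0; A1; A2])
    (hrank : scheme_rank [fset A0; A1; A2] = 3%N)
    (hnonsym : nonsymmetric_scheme [fset A0; A1; A2]) :
  assoc_scheme (schemeD A1 A2).
Proof. by subst A0 A2; apply: schemeD_assoc. Qed.
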